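(* Let $a_1,a_2,\ldots\ge 0$, let $C(\theta)=\sum_{n\ge1}a_n\theta^n$ be finite for $\theta\in(0,s)$, fix $\theta\in(0,s)$ with $C(\theta)>0$ and $\alpha_1,\alpha_2,\alpha_3,\lambda>0$. Let $\mathbf Y=(Y_1,Y_2)$ have the $\mathrm{BGEPS}(\alpha_1,\alpha_2,\alpha_3,\lambda,\theta)$ distribution, with joint cdf $$F_{\mathbf Y}(y_1,y_2)=\begin{cases}C\big(\theta F_{GE}(y_1;\alpha_1+\alpha_3,\lambda)F_{GE}(y_2;\alpha_2,\lambda)\big)/C(\theta) & y_1\le y_2,\\ C\big(\theta F_{GE}(y_1;\alpha_1,\lambda)F_{GE}(y_2;\alpha_2+\alpha_3,\lambda)\big)/C(\theta) & y_1>y_2.\end{cases}$$ Then the joint density of $\mathbf Y$ is $f_1(y_1,y_2)$ on $\{0<y_1<y_2\}$, $f_2(y_1,y_2)$ on $\{0<y_2<y_1\}$, and $f_0(y)$ on the diagonal $\{0<y_1=y_2=y\}$, in the sense that for every Borel set $A\subseteq(0,\infty)^2$, $$P(\mathbf Y\in A)=\iint_{A\cap\{y_1<y_2\}}f_1\,dy_1dy_2+\iint_{A\cap\{y_2<y_1\}}f_2\,dy_1dy_2+\int_{\{y:(y,y)\in A\}}f_0(y)\,dy,$$ where, writing $K_1=F_{GE}(y_1;\alpha_1+\alpha_3,\lambda)F_{GE}(y_2;\alpha_2,\lambda)$, $K_2=F_{GE}(y_1;\alpha_1,\lambda)F_{GE}(y_2;\alpha_2+\alpha_3,\lambda)$ and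 $K_0=F_{GE}(y;\alpha_1+\alpha_2+\alpha_3,\lambda)$, $$f_1(y_1,y_2)=\frac{\theta}{C(\theta)}f_{GE}(y_1;\alpha_1+\alpha_3,\lambda)f_{GE}(y_2;\alpha_2,\lambda)\big[\theta K_1C''(\theta K_1)+C'(\theta K_1)\big],$$ $$f_2(y_1,y_2)=\frac{\theta}{C(\theta)}f_{GE}(y_1;\alpha_1,\lambda)f_{GE}(y_2;\alpha_2+\alpha_3,\lambda)\big[\theta K_2C''(\theta K_2)+C'(\theta K_2)\big],$$ $$f_0(y)=\frac{\theta\,\alpha_3}{C(\theta)(\alpha_1+\alpha_2+\alpha_3)}f_{GE}(y;\alpha_1+\alpha_2+\alpha_3,\lambda)\,C'(\theta K_0).$$
   Context: For $\alpha,\lambda>0$ and $x>0$: $F_{GE}(x;\alpha,\lambda)=(1-e^{-\lambda x})^{\alpha}$ and $f_{GE}(x;\alpha,\lambda)=\alpha\lambda e^{-\lambda x}(1-e^{-\lambda x})^{\alpha-1}$ (generalized exponential cdf and pdf). $C'$ and $C''$ denote the first and second derivatives of $C$. *)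

(* Defs.v *)
From HB Require Import structures.
From mathcomp Require Import all_boot all_order all_algebra.
From mathcomp Require Import all_classical all_reals all_analysis.
Set Implicit Arguments. Unset Strict Implicit. Unset Printing Implicit Defensive.
Import Order.TTheory GRing.Theory Num.Theory.
Import numFieldNormedType.Exports.
Local Open Scope classical_set_scope.
Local Open Scope ring_scope.

Definition FGE (R : realType) (alpha lam x : R) : R :=
  if x <= 0 then 0 else (1 - expR (- (lam * x))) `^ alpha.

Definition fGE (R : realType) (alpha lam x : R) : R :=
  if x <= 0 then 0
  else alpha * lam * expR (- (lam * x)) * (1 - expR (- (lam * x))) `^ (alpha - 1).

Definition Cpow (R : realType) (a : nat -> R) (t : R) : R :=
  limn [series a n.+1 * t ^+ n.+1]_n.

Definition dC (R : realType) (a : nat -> R) : R -> R := derive1 (Cpow a).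
Definition d2C (R : realType) (a : nat -> R) : R -> R := derive1 (derive1 (Cpow a)).

Definition F_BGEPS (R : realType) (a : nat -> R) (a1 a2 a3 lam theta y1 y2 : R) : R :=
  if y1 <= y2 then
    Cpow a (theta * (FGE (a1 + a3) lam y1 * FGE a2 lam y2)) / Cpow a theta
  else
    Cpow a (theta * (FGE a1 lam y1 * FGE (a2 + a3) lam y2)) / Cpow a theta.

Definition f1_BGEPS (R : realType) (a : nat -> R) (a1 a2 a3 lam theta y1 y2 : R) : R :=
  let K1 := FGE (a1 + a3) lam y1 * FGE a2 lam y2 in
  theta / Cpow a theta * fGE (a1 + a3) lam y1 * fGE a2 lam y2
  * (theta * K1 * d2C a (theta * K1) + dC a (theta * K1)).

Definition f2_BGEPS (R : realType) (a : nat -> R) (a1 a2 a3 lam theta y1 y2 : R) : R :=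
  let K2 := FGE a1 lam y1 * FGE (a2 + a3) lam y2 in
  theta / Cpow a theta * fGE a1 lam y1 * fGE (a2 + a3) lam y2
  * (theta * K2 * d2C a (theta * K2) + dC a (theta * K2)).

Definition f0_BGEPS (R : realType) (a : nat -> R) (a1 a2 a3 lam theta y : R) : R :=
  let K0 := FGE (a1 + a2 + a3) lam y in
  theta * a3 / (Cpow a theta * (a1 + a2 + a3)) * fGE (a1 + a2 + a3) lam y
  * dC a (theta * K0).

(* Main.v *)
(** Expanding the power series, the joint density is a mixture over [n], with
    weights [a_n theta^n / C(theta)], of the densities of bivariate generalized
    exponential laws with parameters [n alpha_i]: this follows from
    [f_GE(x; n alpha) = n F_GE(x; alpha)^(n-1) f_GE(x; alpha)] and
    [t C''(t) + C'(t) = sum n^2 a_n t^(n-1)].  Each component has product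
    densities off the diagonal, so by Tonelli and the identity
    [f_GE(beta) F_GE(gamma) = beta / (beta + gamma) f_GE(beta + gamma)] its mass
    on a quadrant [(-oo, y1] x (-oo, y2]] is explicit, and summing over [n]
    gives the cdf.  Quadrants form a pi-system generating the Borel sets. *)

Require Import Defs.
From HB Require Import structures.
From mathcomp Require Import all_boot all_order all_algebra.
From mathcomp Require Import all_classical all_reals all_analysis.
From mathcomp Require Import measurable_realfun.
From mathcomp Require Import ring lra.
Set Implicit Arguments.
Unset Strict Implicit.
Import Order.TTheory GRing.Theory Num.Theory.
Import numFieldNormedType.Exports.
Local Open Scope classical_set_scope.
Local Open Scope ring_scope.

(** * Termwise differentiation of power series with nonnegative coefficients *)

Section power_series.
Context {R : realType}.
Implicit Types (c a : nat -> R) (t x : R).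

(** Comparison test: [mvt] bounds the derived terms at [t] by [(t' - t)^-1] times the shifted terms
    of the original series at the larger point [t']. *)
Lemma cvg_pseries_diffs c t t' : (forall n, 0 <= c n) -> 0 < t -> t < t' ->
  cvgn (pseries c t') -> cvgn (pseries (pseries_diffs c) t).
Proof.
move=> c0 t0 tt' cvt'.
have t'0 : 0 < t' by exact: lt_trans tt'.
have mvt n : n.+1%:R * t ^+ n * (t' - t) <= t' ^+ n.+1.
  (* Keeping [- t ^+ n.+1] on the right gives a bound of mean value type that passes through the
     induction. *)
  suff : n.+1%:R * t ^+ n * (t' - t) <= t' ^+ n.+1 - t ^+ n.+1.
    by move/le_trans; apply; rewrite gerBl exprn_ge0// ltW.
  elim: n => [|n IH]; first by rewrite !mul1r !expr1.
  have -> : t' ^+ n.+2 - t ^+ n.+2 =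
      t * (t' ^+ n.+1 - t ^+ n.+1) + t' ^+ n.+1 * (t' - t) by rewrite !exprS; ring.
  have -> : n.+2%:R * t ^+ n.+1 * (t' - t) =
    t * (n.+1%:R * t ^+ n * (t' - t)) + t ^+ n.+1 * (t' - t).
    by rewrite -(natr1 n.+1) !exprS; ring.
  rewrite lerD ?ler_pM2l// ler_pM2r ?subr_gt0//.
  by rewrite lerXn2r ?nnegrE ?ltW.
(* The shifted series differs from [pseries c t'] by one index and the constant term [c 0]. *)
have cvS : cvgn [series c n.+1 * t' ^+ n.+1]_n.
  have /cvg_ex[l hl] := cvt'; apply/cvg_ex; exists (l - c 0%N).
  have -> : [series c n.+1 * t' ^+ n.+1]_n = (fun n => pseries c t' n.+1 - c 0%N).
    apply/funext => n; rewrite /pseries /series/= big_nat_recl//= expr0 mulr1.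
    by rewrite addrC addKr.
  by apply: cvgB; [rewrite cvg_shiftS|exact: cvg_cst].
apply: (@series_le_cvg _ _ (fun n => (t' - t)^-1 * (c n.+1 * t' ^+ n.+1))).
- by move=> n; rewrite /pseries_diffs !mulr_ge0// exprn_ge0// ltW.
- by move=> n; rewrite !mulr_ge0// ?invr_ge0 ?subr_ge0 ?exprn_ge0// ltW.
- move=> n; rewrite /pseries_diffs ler_pdivlMl ?subr_gt0//.
  have -> : (t' - t) * (n.+1%:R * c n.+1 * t ^+ n) =
     c n.+1 * (n.+1%:R * t ^+ n * (t' - t)) by ring.
  by rewrite ler_wpM2l.
- rewrite (_ : series _ =
     (fun n => (t' - t)^-1 * [series c n.+1 * t' ^+ n.+1]_n n)); last first.
    by apply/funext => n; rewrite /series/= mulr_sumr.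
  exact: is_cvgMr.
Qed.

(** [Cpow] sums from index 1 and [a 0] has no prescribed sign, so that coefficient is set to 0; this
    makes [Cpow] an ordinary power series with nonnegative coefficients. *)
Definition coef0 a n : R := if n is m.+1 then a m.+1 else 0.

(** The partial sums agree up to a shift by one, hence have the same limit predicate. Equality of
    the chosen limits follows even where the series diverges. *)
Lemma CpowE a : Cpow a = fun t => limn (pseries (coef0 a) t).
Proof.
apply/funext => t; rewrite /Cpow /lim; congr (get _).
apply/funext => l; rewrite -(cvg_shiftS (pseries (coef0 a) t)).
rewrite (_ : [series _]_n = fun n => pseries (coef0 a) t n.+1)//.
apply/funext => n.
by rewrite /pseries /series/= big_nat_recl//= mul0r add0r.
Qed.

Lemma pseries_diffs_ge0 c : (forall n, 0 <= c n) ->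
  forall n, 0 <= pseries_diffs c n.
Proof. by move=> c0 n; rewrite /pseries_diffs mulr_ge0. Qed.

Lemma derive1_pseries c t : (forall n, 0 <= c n) ->
  0 < t -> (exists2 t', t < t' & cvgn (pseries c t')) ->
  derive1 (fun x => limn (pseries c x)) t = limn (pseries (pseries_diffs c) t).
Proof.
move=> c0 t0 [t' tt' ct'].
have d0 := pseries_diffs_ge0 c0.
(* [pseries_snd_diffs] asks for convergence of the series and of its first two derived series at one
   point beyond [t]. Each differentiation moves the point strictly inwards, so [t < t2 < t1 < t']:
   the first derived series converges at [t1], the second at [t2]. *)
pose t1 := (t + t') / 2; pose t2 := (t + t1) / 2.
have tt1 : t < t1 by rewrite /t1; lra.
have t1t' : t1 < t' by rewrite /t1; lra.
have tt2 : t < t2 by rewrite /t2; lra.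
have t2t1 : t2 < t1 by rewrite /t2; lra.
have t10 : 0 < t1 by lra.
have t20 : 0 < t2 by lra.
have k1 : cvgn (pseries (pseries_diffs c) t1) by exact: cvg_pseries_diffs ct'.
have ltn x y : 0 < x -> x < y -> `|x| < `|y| :> R.
  by move=> x0 xy; rewrite !gtr0_norm//; lra.
have k2 : cvgn (pseries (pseries_diffs (pseries_diffs c)) t2).
  exact: cvg_pseries_diffs k1.
rewrite derive1E; apply: derive_val; apply: (@pseries_snd_diffs _ c t2) => //.
- by apply: is_cvg_pseries_inside ct' _; apply: ltn; lra.
- by apply: is_cvg_pseries_inside k1 _; exact: ltn.
- exact: ltn.
Qed.

Lemma dC_pseries a t : (forall n, 0 <= coef0 a n) ->
  0 < t -> (exists2 t', t < t' & cvgn (pseries (coef0 a) t')) ->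
  dC a t = limn (pseries (pseries_diffs (coef0 a)) t).
Proof. by move=> a0 t0 ht; rewrite /dC CpowE derive1_pseries. Qed.

Lemma d2C_pseries a t : (forall n, 0 <= coef0 a n) ->
  0 < t -> (exists2 t', t < t' & cvgn (pseries (coef0 a) t')) ->
  d2C a t = limn (pseries (pseries_diffs (pseries_diffs (coef0 a))) t).
Proof.
move=> a0 t0 [t' tt' ct'].
pose t1 := (t + t') / 2.
have tt1 : t < t1 by rewrite /t1; lra.
have t1t' : t1 < t' by rewrite /t1; lra.
rewrite -derive1_pseries//; first last.
- by exists t1 => //; apply: cvg_pseries_diffs ct' => //; lra.
- exact: pseries_diffs_ge0.
(* The derivative is local, so [dC] may be replaced by its series on a neighbourhood of [t] inside
   []0, t'[]. *)
rewrite /d2C !derive1E; apply: near_eq_derive.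
near=> x; apply: dC_pseries => //.
  by near: x; exact: lt_nbhsr.
by exists t' => //; near: x; exact: lt_nbhsl.
Unshelve. all: by end_near. Qed.

Lemma cvg_dC a t : (forall n, 0 <= coef0 a n) ->
  0 < t -> (exists2 t', t < t' & cvgn (pseries (coef0 a) t')) ->
  [series n.+1%:R * a n.+1 * t ^+ n]_n @ \oo --> dC a t.
Proof.
move=> a0 t0 ht; rewrite dC_pseries//; case: ht => t' tt' ct'.
exact: cvg_pseries_diffs ct'.
Qed.

(** Coefficientwise this is [m (m - 1) + m = m ^ 2] with [m = n + 1]. *)
Lemma cvg_d2C_dC a t : (forall n, 0 <= coef0 a n) ->
  0 < t -> (exists2 t', t < t' & cvgn (pseries (coef0 a) t')) ->
  [series n.+1%:R ^+ 2 * a n.+1 * t ^+ n]_n @ \oo --> t * d2C a t + dC a t.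
Proof.
move=> a0 t0 ht; have d1 := cvg_dC a0 t0 ht.
rewrite d2C_pseries//; case: ht => t' tt' ct'.
pose t1 := (t + t') / 2.
have tt1 : t < t1 by rewrite /t1; lra.
have t1t' : t1 < t' by rewrite /t1; lra.
have k1 : cvgn (pseries (pseries_diffs (coef0 a)) t1).
  by apply: cvg_pseries_diffs ct' => //; lra.
have k2 : cvgn (pseries (pseries_diffs (pseries_diffs (coef0 a))) t).
  by apply: cvg_pseries_diffs k1 => //; exact: pseries_diffs_ge0.
(* In this form of the second derivative the power is [i.-1]; multiplication by [t] restores
   [t ^+ i], and the factor [i] kills the term at 0. *)
have d2 := pseries_diffs_equiv k2.
rewrite (_ : [series _]_n = fun n =>
    t * [series i%:R * pseries_diffs (coef0 a) i * t ^+ i.-1]_i n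
    + [series i.+1%:R * a i.+1 * t ^+ i]_i n); last first.
  apply/funext => n; rewrite /series/= mulr_sumr -big_split/=.
  apply: eq_bigr => -[|i] _; first by rewrite expr1n !mul0r mulr0 add0r.
  by rewrite /pseries_diffs -(natr1 i.+1) [t ^+ i.+1]exprS/=; ring.
by apply: cvgD d1; apply: cvgM d2; exact: cvg_cst.
Qed.

End power_series.

(** * The generalized exponential law: power identities, derivative of the cdf, integral of the
    density *)

Section generalized_exponential.
Context {R : realType}.
Variable lam : R.
Hypothesis lam0 : 0 < lam.
Implicit Types (x b al be ga : R) (n : nat).

Local Notation U x := (1 - expR (- (lam * x))).

Lemma one_sub_expR_gt0 x : 0 < x -> 0 < U x.
Proof. by move=> x0; rewrite subr_gt0 expR_lt1 oppr_lt0 mulr_gt0. Qed.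

Lemma FGE_le0 al x : x <= 0 -> FGE al lam x = 0.
Proof. by rewrite /FGE => ->. Qed.

Lemma FGE_pos al x : 0 < x -> FGE al lam x = U x `^ al.
Proof. by move=> x0; rewrite /FGE leNgt x0. Qed.

Lemma fGE_le0 al x : x <= 0 -> fGE al lam x = 0.
Proof. by rewrite /fGE => ->. Qed.

Lemma fGE_pos al x : 0 < x ->
  fGE al lam x = al * lam * expR (- (lam * x)) * U x `^ (al - 1).
Proof. by move=> x0; rewrite /fGE leNgt x0. Qed.

Lemma FGE_ge0 al x : 0 <= FGE al lam x.
Proof. by rewrite /FGE; case: ifPn => // _; exact: powR_ge0. Qed.

Lemma FGE_gt0 al x : 0 < x -> 0 < FGE al lam x.
Proof. by move=> x0; rewrite FGE_pos// powR_gt0// one_sub_expR_gt0. Qed.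

Lemma FGE_le1 al x : 0 <= al -> FGE al lam x <= 1.
Proof.
move=> al0; have [x0|x0] := leP x 0; first by rewrite FGE_le0.
rewrite FGE_pos//; apply: (@le_trans _ _ (1 `^ al)); last by rewrite powR1.
rewrite ge0_ler_powR ?nnegrE ?(ltW (one_sub_expR_gt0 _))//.
Qed.

Lemma fGE_ge0 al x : 0 <= al -> 0 <= fGE al lam x.
Proof.
move=> al0; rewrite /fGE; case: ifPn => // _.
by rewrite !mulr_ge0 ?powR_ge0 ?expR_ge0// ltW.
Qed.

Lemma FGE_mulrn al n x :
  FGE (n.+1%:R * al) lam x = FGE al lam x ^+ n.+1.
Proof.
have [x0|x0] := leP x 0; first by rewrite !FGE_le0// expr0n.
by rewrite !FGE_pos// (mulrC _ al) powRrM powR_mulrn// powR_ge0.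
Qed.

Lemma fGE_FGE be ga x : be + ga != 0 ->
  fGE be lam x * FGE ga lam x = be / (be + ga) * fGE (be + ga) lam x.
Proof.
move=> bg0; have [x0|x0] := leP x 0; first by rewrite !fGE_le0// mul0r mulr0.
(* The exponents of [U x] add up; [powRD] is applicable because [U x] is positive. *)
rewrite !fGE_pos// FGE_pos// -mulrA -powRD; last first.
  by rewrite [U x == 0]gt_eqF ?implybT// one_sub_expR_gt0.
rewrite (_ : be - 1 + ga = be + ga - 1); last by ring.
by field.
Qed.

Lemma fGE_mulrn al n x :
  n.+1%:R * FGE al lam x ^+ n * fGE al lam x = fGE (n.+1%:R * al) lam x.
Proof.
have [x0|x0] := leP x 0; first by rewrite !fGE_le0// mulr0.
case: n => [|n]; first by rewrite expr0 mulr1 !mul1r.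
rewrite -FGE_mulrn !fGE_pos// FGE_pos//.
rewrite (_ : n.+2%:R * al - 1 = n.+1%:R * al + (al - 1)); last first.
  by rewrite -(natr1 n.+1); ring.
rewrite (@powRD _ _ (n.+1%:R * al)); last first.
  by rewrite [U x == 0]gt_eqF ?implybT// one_sub_expR_gt0.
by ring.
Qed.

Lemma measurable_fGE al : measurable_fun setT (fGE al lam).
Proof.
have mexp : measurable_fun setT (fun x => expR (- (lam * x))).
  apply: (measurableT_comp (@measurable_expR _)).
  by apply: measurableT_comp => //; exact: measurable_funM.
apply: measurable_fun_ifT => //.
- exact: measurable_fun_ler.
- apply: measurable_funM; first exact: measurable_funM.
  apply: (measurableT_comp (measurable_powR _)).
  exact: measurable_funB.
Qed.

Let is_derive_exp x :
  is_derive x 1 (fun x => expR (- (lam * x))) (- lam * expR (- (lam * x))).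
Proof.
have h : is_derive x 1 (fun x => - (lam * x)) (- lam).
  by apply: is_derive_eq; rewrite /GRing.scale/= mulr1.
rewrite mulrC; exact: (is_derive1_comp (is_derive_expR _) h).
Qed.

Let is_derive_U x : is_derive x 1 (fun x => U x) (lam * expR (- (lam * x))).
Proof.
have h := is_deriveB (is_derive_cst (1 : R) x 1) (is_derive_exp x).
by apply: is_derive_eq h _; rewrite sub0r mulNr opprK.
Qed.

Let is_derive_powU al x : 0 < x -> is_derive x 1 (fun x => U x `^ al)
  (al * U x `^ (al - 1) * (lam * expR (- (lam * x)))).
Proof.
move=> x0; have h := is_derive1_powR al (one_sub_expR_gt0 x0).
exact: (@is_derive1_comp _ (fun y => y `^ al) (fun x => U x) x _ _ h (is_derive_U x)).
Qed.

Lemma is_derive_FGE al x : 0 < x ->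
  is_derive x 1 (FGE al lam) (fGE al lam x).
Proof.
move=> x0; apply: (@near_eq_is_derive _ _ _ (fun x => U x `^ al)).
  by near=> y; rewrite FGE_pos//; near: y; exact: lt_nbhsr.
by apply: is_derive_eq (is_derive_powU al x0) _; rewrite fGE_pos//; ring.
Unshelve. all: by end_near. Qed.

Lemma continuous_FGE al x : 0 < x -> {for x, continuous (FGE al lam)}.
Proof.
move=> x0; apply: differentiable_continuous; apply/derivable1_diffP.
by have [] := is_derive_FGE al x0.
Qed.

Lemma continuous_fGE al x : 0 < x -> {for x, continuous (fGE al lam)}.
Proof.
move=> x0; apply: differentiable_continuous; apply/derivable1_diffP.
apply: (@near_eq_derivable _ _ _
    (fun x => al * lam * expR (- (lam * x)) * U x `^ (al - 1))).
  by near=> y; rewrite fGE_pos//; near: y; exact: lt_nbhsr.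
have h := is_derive_powU (al - 1) x0.
by apply: derivableM => //; apply: derivableM.
Unshelve. all: by end_near. Qed.

(** The lower endpoint is kept positive because the density is unbounded near 0 when [0 < al < 1];
    on [[x, b]] the fundamental theorem of calculus applies. *)
Lemma integral_fGE_itvcc al x b : 0 < x -> x < b ->
  (\int[lebesgue_measure]_(y in `[x, b]) (fGE al lam y)%:E =
   (FGE al lam b)%:E - (FGE al lam x)%:E)%E.
Proof.
move=> x0 xb; apply: continuous_FTC2 => //.
- apply: continuous_in_subspaceT => y; rewrite inE/= in_itv/= => /andP[xy _].
  exact/continuous_fGE/(lt_le_trans x0).
- split.
  + move=> y; rewrite in_itv/= => /andP[xy _].
    by have [] := is_derive_FGE al (lt_trans x0 xy).
  + exact/cvg_at_right_filter/continuous_FGE.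
  + exact/cvg_at_left_filter/continuous_FGE/(lt_trans x0).
- move=> y; rewrite in_itv/= => /andP[xy _].
  have h := is_derive_FGE al (lt_trans x0 xy).
  by rewrite derive1E derive_val.
Qed.

Lemma cvg_FGE_0 al b : 0 < al -> 0 < b ->
  FGE al lam (b / n.+2%:R) @[n --> \oo] --> 0.
Proof.
move=> al0 b0.
have x0 n : 0 < b / n.+2%:R by rewrite divr_gt0.
under eq_fun do rewrite FGE_pos//.
(* The right limit of the power function at 0 is tested along the positive sequence
   [U (b / n.+2%:R)], which tends to [U 0 = 0] by continuity. *)
have /cvg_at_rightP := @powR_cvg0 R al al0; apply; split => [n|].
  exact: one_sub_expR_gt0.
have cx : b / n.+2%:R @[n --> \oo] --> 0.
  rewrite -(mulr0 b); apply: cvgM; first exact: cvg_cst.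
  by rewrite (cvg_shiftS (@harmonic R)); exact: cvg_harmonic.
have cU : {for 0, continuous (fun x => U x)}.
  apply: differentiable_continuous; apply/derivable1_diffP.
  by have [] := is_derive_U 0.
have -> : 0 = U 0 by rewrite mulr0 oppr0 expR0 subrr.
exact: (continuous_cvg _ cU cx).
Qed.

(** Monotone convergence along intervals increasing to []0, b]]; the boundary term at the left
    endpoint vanishes by [cvg_FGE_0], where [0 < al] enters. *)
Lemma integral_fGE al b : 0 < al ->
  (\int[lebesgue_measure]_(y in `]-oo, b]) (fGE al lam y)%:E =
   (FGE al lam b)%:E)%E.
Proof.
move=> al0; have [b0|b0] := leP b 0.
  rewrite FGE_le0// integral0_eq// => y; rewrite /= in_itv/= => yb.
  by rewrite fGE_le0// (le_trans yb).
transitivity (\int[lebesgue_measure]_(y in `]0%R, b]) (fGE al lam y)%:E)%E.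
  rewrite [LHS]integral_mkcond [RHS]integral_mkcond; apply: eq_integral => y _.
  rewrite !patchE !mem_setE !in_itv/=; have [y0|y0]//= := ltP 0 y.
  by rewrite fGE_le0// if_same.
(* With [n.+2] the left endpoint is strictly below [b] already for [n = 0], as [integral_fGE_itvcc]
   demands. *)
have -> : [set` `]0, b]] = \bigcup_n [set` `[b / n.+2%:R, b]].
  apply/seteqP; split => y /=; rewrite in_itv/=.
    move=> /andP[y0 yb].
    have [n bn] := ltr_add_invr (divr_gt0 y0 b0).
    exists n => //=; rewrite in_itv/= yb andbT.
    rewrite add0r ltr_pdivlMr// in bn.
    rewrite mulrC (le_trans _ (ltW bn))// ler_pM2r// lef_pV2 ?posrE//.
    by rewrite ler_nat.
  by move=> [n _]; rewrite /= in_itv/= => /andP[+ ->]; rewrite andbT;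
    apply: lt_le_trans; rewrite divr_gt0.
have mf n : measurable_fun [set` `[b / n.+2%:R, b]] (fun x : R => (fGE al lam x)%:E).
  by apply/measurable_EFinP; apply: measurable_funTS; exact: measurable_fGE.
have F0 (i : nat) x : [set` `[b / i.+2%:R, b]] x -> (0 <= (fGE al lam x)%:E)%E.
  by move=> _; rewrite lee_fin fGE_ge0// ltW.
have nd : nondecreasing_seq (fun n => [set` `[b / n.+2%:R, b]]).
  move=> m n mn; apply/subsetPset; apply: subset_itvr; rewrite bnd_simp.
  by rewrite ler_pM2l// lef_pV2 ?posrE// ler_nat.
have := @ge0_nondecreasing_set_cvg_integral _ _ R _ _ lebesgue_measure nd
  (fun=> measurable_itv _) mf F0.
move/cvg_lim => <-//; apply/cvg_lim => //.
rewrite (_ : (fun _ => _) =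
    (fun n => (FGE al lam b)%:E - (FGE al lam (b / n.+2%:R))%:E)%E); last first.
  apply/funext => n; apply: integral_fGE_itvcc; first by rewrite divr_gt0.
  by rewrite ltr_pdivrMr// ltr_pMr// ltr1n.
under eq_fun do rewrite -EFinB.
apply: cvg_EFin; first by near=> n.
rewrite -[X in _ --> X]subr0; apply: cvgB; first exact: cvg_cst.
exact: cvg_FGE_0.
Unshelve. all: by end_near. Qed.

End generalized_exponential.

(** * Tonelli's theorem on measurable subsets of a product, and exchange of coordinates *)

Section tonelli_on_sets.
Context d1 d2 (T1 : measurableType d1) (T2 : measurableType d2) (R : realType).
Variables (m1 : {sigma_finite_measure set T1 -> \bar R}).
Variables (m2 : {sigma_finite_measure set T2 -> \bar R}).
Local Open Scope ereal_scope.

Lemma tonelli_xsection (A : set (T1 * T2)) (f : T1 * T2 -> \bar R) :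
  measurable A -> measurable_fun setT f -> (forall z, 0 <= f z) ->
  \int[m1 \x m2]_(z in A) f z =
  \int[m1]_x \int[m2]_(y in xsection A x) f (x, y).
Proof.
move=> mA mf f0; rewrite integral_mkcond fubini_tonelli1; last 2 first.
- by apply/measurable_restrict => //; exact: measurable_funTS.
- by move=> z; exact: erestrict_ge0.
apply: eq_integral => x _; rewrite /fubini_F [RHS]integral_mkcond.
by apply: eq_integral => y _; rewrite !patchE mem_xsection.
Qed.

End tonelli_on_sets.

(** Tonelli is applied in opposite orders to the two sides, which then become the same iterated
    integral. *)
Lemma integral_swap d (T : measurableType d) (R : realType)
    (m : {sigma_finite_measure set T -> \bar R})
    (A : set (T * T)) (f : T * T -> \bar R) :
  measurable A -> measurable_fun setT f -> (forall z, (0 <= f z)%E) ->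
  (\int[(m \x m)%E]_(z in A) f z =
   \int[(m \x m)%E]_(z in (fun z => (z.2, z.1)) @^-1` A) f (z.2, z.1))%E.
Proof.
move=> mA mf f0.
have msw : measurable_fun setT (fun z : T * T => (z.2, z.1)).
  by apply/measurable_fun_pairP; split; [exact: measurable_snd|exact: measurable_fst].
have mB : measurable ((fun z : T * T => (z.2, z.1)) @^-1` A).
  by rewrite -[X in measurable X]setTI; exact: msw.
rewrite [LHS]integral_mkcond [RHS]integral_mkcond.
rewrite fubini_tonelli1; last 2 first.
- by apply/measurable_restrict => //; exact: measurable_funTS.
- by move=> z; exact: erestrict_ge0.
rewrite fubini_tonelli2; last 2 first.
- apply/measurable_restrict => //.
  by apply: measurable_funTS; exact: measurableT_comp.
- by move=> z; apply: erestrict_ge0 => ?.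
by apply: eq_integral => x _; rewrite /fubini_F /fubini_G; apply: eq_integral.
Qed.

(** * Measures given by a density, and image measures *)

Section density.
Context d (T : measurableType d) (R : realType).
Variables (m : {measure set T -> \bar R}) (f : T -> \bar R).
Hypotheses (mf : measurable_fun setT f) (f0 : forall x, (0 <= f x)%E).
Local Open Scope ereal_scope.

(** The proofs are arguments of the set function so that a canonical measure structure can be
    attached to it; [image_measure] follows the same pattern. *)
Definition density of measurable_fun setT f & (forall x, 0 <= f x) :
  set T -> \bar R := fun A => \int[m]_(x in A) f x.

Local Notation dens := (density mf f0).

Let density0 : dens set0 = 0.
Proof. exact: integral_set0. Qed.

Let density_ge0 A : 0 <= dens A.
Proof. exact: integral_ge0. Qed.

Let density_sigma_additive : semi_sigma_additive dens.
Proof.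
move=> F mF tF mUF; rewrite /density ge0_integral_bigcup//; last first.
  exact: measurable_funTS.
by apply: is_cvg_ereal_nneg_natsum_cond => n _ _; exact: integral_ge0.
Qed.

HB.instance Definition _ := isMeasure.Build _ _ _ dens
  density0 density_ge0 density_sigma_additive.

End density.

Section image_measure.
Context d1 d2 (T1 : measurableType d1) (T2 : measurableType d2) (R : realType).
Variables (m : {measure set T1 -> \bar R}) (f : T1 -> T2).
Hypothesis mf : measurable_fun setT f.

Definition image_measure of measurable_fun setT f : set T2 -> \bar R :=
  pushforward m f.

Let image_measure0 : image_measure mf set0 = 0%E.
Proof. exact: measure0. Qed.

Let image_measure_ge0 A : (0 <= image_measure mf A)%E.
Proof. exact: measure_ge0. Qed.

Let image_measure_sigma_additive : semi_sigma_additive (image_measure mf).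
Proof. exact: measure_semi_sigma_additive. Qed.

HB.instance Definition _ := isMeasure.Build _ _ _ (image_measure mf)
  image_measure0 image_measure_ge0 image_measure_sigma_additive.

End image_measure.

(** * Quadrants generate the Borel sets of the plane and determine finite measures *)

Section quadrants.
Context {R : realType}.

Definition quadrant (a b : R) : set (R * R) := [set z | z.1 <= a /\ z.2 <= b].

Lemma quadrantE a b : quadrant a b = [set` `]-oo, a]] `*` [set` `]-oo, b]].
Proof. by apply/seteqP; split=> z; rewrite /quadrant/= !in_itv/=. Qed.

Lemma measurable_quadrant a b : measurable (quadrant a b).
Proof. by rewrite quadrantE; apply: measurableX; exact: measurable_itv. Qed.

Definition quadrants : set (set (R * R)) :=
  [set A | exists a b, A = quadrant a b].

(** It suffices that both projections are measurable for the generated sigma-algebra: the preimage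
    of []x, +oo[] is the complement of a countable union of quadrants, the other coordinate being
    bounded by [k]. *)
Lemma measurable_quadrants : @measurable _ (R * R)%type = <<s quadrants >>.
Proof.
pose G := g_sigma_algebraType quadrants.
have mQ a b : @measurable _ G (quadrant a b).
  by apply: sub_sigma_algebra; exists a, b.
have mfst : measurable_fun setT (fun z : G => z.1 : R).
  apply: (measurability _ (RGenOInfty.measurableE R)) => _ [_ [x ->] <-].
  rewrite setTI (_ : _ @^-1` _ = ~` \bigcup_k (quadrant x k%:R)).
    by apply: measurableC; apply: bigcup_measurable => k _; exact: mQ.
  apply/seteqP; split => z /=; rewrite in_itv/= andbT ltNge.
    by move=> /negP zx [k _ [? _]].
  move=> zx; apply/negP => zx'; apply: zx; exists (Num.trunc `|z.2|).+1 => //.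
  by split => //; rewrite (le_trans (ler_norm _))// ltW// truncnS_gt.
have msnd : measurable_fun setT (fun z : G => z.2 : R).
  apply: (measurability _ (RGenOInfty.measurableE R)) => _ [_ [x ->] <-].
  rewrite setTI (_ : _ @^-1` _ = ~` \bigcup_k (quadrant k%:R x)).
    by apply: measurableC; apply: bigcup_measurable => k _; exact: mQ.
  apply/seteqP; split => z /=; rewrite in_itv/= andbT ltNge.
    by move=> /negP zx [k _ [_ ?]].
  move=> zx; apply/negP => zx'; apply: zx; exists (Num.trunc `|z.1|).+1 => //.
  by split => //; rewrite (le_trans (ler_norm _))// ltW// truncnS_gt.
apply/seteqP; split; apply: smallest_sub.
- exact: smallest_sigma_algebra.
- move=> _ [] [B mB <-].
  + exact: mfst.
  + exact: msnd.
- exact: sigma_algebra_measurable.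
- by move=> _ [a [b ->]]; exact: measurable_quadrant.
Qed.

(** Uniqueness on a pi-system: quadrants intersect by componentwise minimum, and those with corner
    [(k, k)] exhaust the plane with finite mass. *)
Lemma measure_unique_quadrants (m1 m2 : {measure set (R * R) -> \bar R}) :
  (forall a b, m1 (quadrant a b) = m2 (quadrant a b)) ->
  (forall a b, (m1 (quadrant a b) < +oo)%E) ->
  forall A, measurable A -> m1 A = m2 A.
Proof.
move=> m12 m1oo A mA.
apply: (@measure_unique _ R _ quadrants (fun k => quadrant k%:R k%:R)) => //.
- exact: measurable_quadrants.
- move=> _ _ [a [b ->]] [a' [b' ->]]; exists (Num.min a a'), (Num.min b b').
  apply/seteqP; split => z; rewrite /quadrant/= !le_min.
    by move=> [[-> ->] [-> ->]].
  by move=> [/andP[-> ->] /andP[-> ->]].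
- by move=> k; exists k%:R, k%:R.
- apply/seteqP; split => // z _.
  exists (Num.trunc (Num.max `|z.1| `|z.2|)).+1 => //.
  have := truncnS_gt (Num.max `|z.1| `|z.2|); rewrite gt_max => /andP[z1 z2].
  by split; rewrite (le_trans (ler_norm _))// ltW.
- by move=> _ [a [b ->]].
Qed.

End quadrants.

(** * Mass of a quadrant for one component, for an abstract family of densities [g] and cdfs [G]
    linked by [gG] *)

Section bivariate_integrals.
Context {R : realType}.
Local Notation mu := (@lebesgue_measure R).
Variables g G : R -> R -> R.
Hypothesis g_ge0 : forall be x, 0 < be -> 0 <= g be x.
Hypothesis G_ge0 : forall be x, 0 <= G be x.
Hypothesis mg : forall be, measurable_fun setT (g be).
Hypothesis integral_g : forall be b, 0 < be ->
  (\int[mu]_(y in `]-oo, b]) (g be y)%:E = (G be b)%:E)%E.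
Hypothesis gG : forall be ga x, 0 < be -> 0 < ga ->
  g be x * G ga x = be / (be + ga) * g (be + ga) x.
Implicit Types (be ga y b : R).

(** The names describe the first coordinate: it is the smaller one on [lower], the region above the
    diagonal. *)
Definition lower : set (R * R) := [set z | z.1 < z.2].
Definition upper : set (R * R) := [set z | z.2 < z.1].

Lemma measurable_lower : measurable lower.
Proof.
rewrite -[lower]setTI; have := @measurable_fun_ltr _ (R * R)%type R setT _ _
  measurable_fst measurable_snd measurableT [set true]; exact.
Qed.

Lemma measurable_upper : measurable upper.
Proof.
rewrite -[upper]setTI; have := @measurable_fun_ltr _ (R * R)%type R setT _ _
  measurable_snd measurable_fst measurableT [set true]; exact.
Qed.

Definition prod_g be ga (z : R * R) : \bar R :=
  (g be z.1 * g ga z.2)%:E.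

Lemma measurable_prod_g be ga : measurable_fun setT (prod_g be ga).
Proof.
apply/measurable_EFinP; apply: measurable_funM.
- exact: (measurableT_comp (mg be) measurable_fst).
- exact: (measurableT_comp (mg ga) measurable_snd).
Qed.

Lemma prod_g_ge0 be ga z : 0 < be -> 0 < ga -> (0 <= prod_g be ga z)%E.
Proof. by move=> be0 ga0; rewrite lee_fin mulr_ge0// g_ge0. Qed.

(** The flag [b = true] makes the endpoint [y] open; the value is unaffected since a point is
    Lebesgue-null. *)
Lemma integral_g_scaled (c be y : R) (b : bool) : 0 <= c -> 0 < be ->
  (\int[mu]_(x in [set` Interval -oo%O (BSide b y)]) (c * g be x)%:E =
   (c * G be y)%:E)%E.
Proof.
move=> c0 be0; under eq_integral do rewrite EFinM.
rewrite ge0_integralZl//; last 2 first.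
- by apply/measurable_EFinP/measurable_funTS; exact: mg.
- by move=> x _; rewrite lee_fin g_ge0.
rewrite EFinM; congr (_ * _)%E.
rewrite -(integral_g y be0); case: b => //.
by rewrite integral_itv_bndo_bndc//; apply/measurable_EFinP/measurable_funTS;
  exact: mg.
Qed.

(** Tonelli with the second coordinate integrated first: each section is a half-line ending at
    [t x]. A constant [t] yields a quadrant, the identity yields the region below the diagonal. *)
Lemma integral_prod_g be ga y1 (A : set (R * R)) (b : bool) (t : R -> R) :
  0 < be -> 0 < ga -> measurable A ->
  (forall x y, A (x, y) <-> x <= y1 /\ (y < t x ?<= if ~~ b)) ->
  (\int[(mu \x mu)%E]_(z in A) prod_g be ga z =
   \int[mu]_(x in `]-oo, y1]) (g be x * G ga (t x))%:E)%E.
Proof.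
move=> be0 ga0 mA At; rewrite tonelli_xsection//; last 2 first.
- exact: measurable_prod_g.
- by move=> z; exact: prod_g_ge0.
rewrite [RHS]integral_mkcond; apply: eq_integral => x _.
rewrite patchE mem_setE in_itv/=; case: ifPn => [xy1|/negP xy1].
  rewrite -(@integral_g_scaled _ _ _ b)// ?g_ge0//.
  congr (integral _ _ _); apply/seteqP; split => y; rewrite /xsection/= inE in_itv/=.
    by move=> /At[].
  by move=> yt; apply/At.
rewrite (_ : xsection A x = set0) ?integral_set0//.
by apply/seteqP; split => // y; rewrite /xsection/= inE => /At[].
Qed.

Lemma integral_quadrant be ga y1 y2 : 0 < be -> 0 < ga ->
  (\int[(mu \x mu)%E]_(z in quadrant y1 y2) prod_g be ga z =
   (G be y1 * G ga y2)%:E)%E.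
Proof.
move=> be0 ga0.
rewrite (@integral_prod_g _ _ y1 _ false (fun=> y2))//; last first.
  exact: measurable_quadrant.
under eq_integral do rewrite mulrC.
have -> : G be y1 * G ga y2 = G ga y2 * G be y1.
  exact: mulrC.
exact: (@integral_g_scaled _ _ _ false (G_ge0 _ _) be0).
Qed.

(** The inner integral leaves [g be x * G ga x], which [gG] turns into a multiple of
    [g (be + ga) x]. Both values of [b] are used: strict for [upper], non-strict for the complement
    of [lower]. *)
Lemma integral_below_diagonal be ga y1 (A : set (R * R)) (b : bool) :
  0 < be -> 0 < ga -> measurable A ->
  (forall x y, A (x, y) <-> x <= y1 /\ (y < x ?<= if ~~ b)) ->
  (\int[(mu \x mu)%E]_(z in A) prod_g be ga z =
   (be / (be + ga) * G (be + ga) y1)%:E)%E.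
Proof.
move=> be0 ga0 mA At; have bg0 := addr_gt0 be0 ga0.
rewrite (@integral_prod_g _ _ y1 _ b id)//.
under eq_integral do rewrite gG//.
apply: (@integral_g_scaled _ _ _ false); last exact: bg0.
by rewrite divr_ge0// ltW.
Qed.

Lemma integral_quadrant_upper be ga y1 y2 : 0 < be -> 0 < ga -> y1 <= y2 ->
  (\int[(mu \x mu)%E]_(z in quadrant y1 y2 `&` upper) prod_g be ga z =
   (be / (be + ga) * G (be + ga) y1)%:E)%E.
Proof.
move=> be0 ga0 y12; apply: (@integral_below_diagonal _ _ _ _ true) => //.
  by apply: measurableI; [exact: measurable_quadrant|exact: measurable_upper].
move=> x y; rewrite /quadrant /upper/=; split => [[[? _]]//|[xy1 yx]].
(* The bound by [y2] is automatic, since [y < x <= y1 <= y2]. *)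
by split => //; split => //; rewrite (le_trans (ltW yx))// (le_trans xy1).
Qed.

(** The quadrant is split into [lower] and its complement. The additive form avoids subtraction of
    extended reals. *)
Lemma integral_quadrant_lower be ga y1 y2 : 0 < be -> 0 < ga -> y1 <= y2 ->
  (\int[(mu \x mu)%E]_(z in quadrant y1 y2 `&` lower) prod_g be ga z
   + (be / (be + ga) * G (be + ga) y1)%:E =
   (G be y1 * G ga y2)%:E)%E.
Proof.
move=> be0 ga0 y12; have mQ := measurable_quadrant y1 y2.
have mL := measurable_lower.
rewrite -integral_quadrant// -(@integral_below_diagonal be ga y1
  (quadrant y1 y2 `&` ~` lower) false)//; last 2 first.
- by apply: measurableI => //; exact: measurableC.
- move=> x y; rewrite /quadrant /lower/=; split => [[[? _]] /negP|[xy1 yx]].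
    by rewrite -leNgt.
  split; last by apply/negP; rewrite -leNgt.
  by split => //; rewrite (le_trans yx)// (le_trans xy1).
rewrite -ge0_integral_setU//.
- by rewrite -setIUr setUv setIT.
- exact: measurableI.
- by apply: measurableI => //; exact: measurableC.
- by apply: measurable_funTS; exact: measurable_prod_g.
- by move=> z _; exact: prod_g_ge0.
- by apply/disj_set2P; rewrite setIACA setICr setI0.
Qed.

Lemma integral_swap_prod be ga (A B : set (R * R)) : 0 < be -> 0 < ga ->
  measurable A -> (forall x y, A (x, y) <-> B (y, x)) ->
  (\int[(mu \x mu)%E]_(z in A) prod_g be ga z =
   \int[(mu \x mu)%E]_(z in B) prod_g ga be z)%E.
Proof.
move=> be0 ga0 mA AB.
have f0 z : (0 <= prod_g be ga z)%E by exact: prod_g_ge0.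
apply: (etrans (integral_swap mu mA (measurable_prod_g be ga) f0)).
have -> : (fun z : R * R => (z.2, z.1)) @^-1` A = B.
  by apply/seteqP; split => -[x y] /=; rewrite AB.
by apply: eq_integral => z _; rewrite /prod_g/= mulrC.
Qed.

(** Put [S = b1 + b2 + b3]. If [y1 <= y2], then [upper] contributes [b1 / S] and the diagonal
    [b3 / S] times [G S y1]; their sum is exactly what completes [lower] to the product in
    [integral_quadrant_lower]. The other case is its mirror image. *)
Lemma quadrant_mass (b1 b2 b3 y1 y2 : R) : 0 < b1 -> 0 < b2 -> 0 < b3 ->
  (\int[(mu \x mu)%E]_(z in quadrant y1 y2 `&` lower) prod_g (b1 + b3) b2 z
   + \int[(mu \x mu)%E]_(z in quadrant y1 y2 `&` upper) prod_g b1 (b2 + b3) z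
   + \int[mu]_(y in `]-oo, Num.min y1 y2])
      (b3 / (b1 + b2 + b3) * g (b1 + b2 + b3) y)%:E =
  (if y1 <= y2 then G (b1 + b3) y1 * G b2 y2
   else G b1 y1 * G (b2 + b3) y2)%:E)%E.
Proof.
move=> b10 b20 b30; have b130 := addr_gt0 b10 b30; have b230 := addr_gt0 b20 b30.
have b0 : 0 < b1 + b2 + b3 by rewrite !addr_gt0.
have bC : b1 + b3 + b2 = b1 + b2 + b3 by ring.
have bA : b1 + (b2 + b3) = b1 + b2 + b3 by ring.
have bD : b2 + b3 + b1 = b1 + b2 + b3 by ring.
have bE : b2 + (b1 + b3) = b1 + b2 + b3 by ring.
have c0 : 0 <= b3 / (b1 + b2 + b3) by rewrite divr_ge0// ltW.
rewrite (@integral_g_scaled _ _ _ false c0 b0).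
have mQL : measurable (quadrant y1 y2 `&` lower).
  by apply: measurableI; [exact: measurable_quadrant|exact: measurable_lower].
have mQU : measurable (quadrant y1 y2 `&` upper).
  by apply: measurableI; [exact: measurable_quadrant|exact: measurable_upper].
have [y12|/ltW y21] := leP y1 y2.
  rewrite -(integral_quadrant_lower b130 b20 y12).
  rewrite integral_quadrant_upper// bC bA -addeA -EFinD; congr (_ + _%:E)%E.
  by rewrite -mulrDl -mulrDl.
rewrite [in RHS]mulrC -(integral_quadrant_lower b230 b10 y21).
rewrite (@integral_swap_prod (b1 + b3) b2 _ (quadrant y2 y1 `&` upper))//; last first.
  by move=> x y; rewrite /quadrant /upper /lower/=; tauto.
rewrite (@integral_swap_prod b1 (b2 + b3) _ (quadrant y2 y1 `&` lower))//; last first.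
  by move=> x y; rewrite /quadrant /upper /lower/=; tauto.
rewrite integral_quadrant_upper// bD bE addeAC addeC; congr (_ + _)%E.
by rewrite -EFinD -mulrDl -mulrDl.
Qed.

End bivariate_integrals.

(** * Countable mixtures of components and the resulting density formula *)

Section mixture.
Context {R : realType}.
Local Notation mu := (@lebesgue_measure R).
Variables g G : R -> R -> R.
Hypothesis g_ge0 : forall be x, 0 < be -> 0 <= g be x.
Hypothesis G_ge0 : forall be x, 0 <= G be x.
Hypothesis mg : forall be, measurable_fun setT (g be).
Hypothesis integral_g : forall be b, 0 < be ->
  (\int[mu]_(y in `]-oo, b]) (g be y)%:E = (G be b)%:E)%E.
Hypothesis gG : forall be ga x, 0 < be -> 0 < ga ->
  g be x * G ga x = be / (be + ga) * g (be + ga) x.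
Variables (p : nat -> R) (a1 a2 a3 : R).
Hypotheses (p0 : forall n, 0 <= p n) (a10 : 0 < a1) (a20 : 0 < a2) (a30 : 0 < a3).
Variables (f1 f2 : R * R -> \bar R) (f0 : R -> \bar R).
(** Parameters stay written as sums of the scaled [n.+1%:R * a_i], so that [quadrant_mass] applies
    to each component with these as its [b_i]. *)
Hypothesis f1E : forall z, f1 z = (\sum_(n <oo) ((p n)%:E *
  prod_g g (n.+1%:R * a1 + n.+1%:R * a3) (n.+1%:R * a2) z))%E.
Hypothesis f2E : forall z, f2 z = (\sum_(n <oo) ((p n)%:E *
  prod_g g (n.+1%:R * a1) (n.+1%:R * a2 + n.+1%:R * a3) z))%E.
Hypothesis f0E : forall y, f0 y = (\sum_(n <oo) ((p n)%:E *
  (n.+1%:R * a3 / (n.+1%:R * a1 + n.+1%:R * a2 + n.+1%:R * a3) *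
   g (n.+1%:R * a1 + n.+1%:R * a2 + n.+1%:R * a3) y)%:E))%E.

Let sc_gt0 a n : 0 < a -> 0 < n.+1%:R * a :> R.
Proof. by move=> h; rewrite mulr_gt0. Qed.

Lemma mixture_ge0 d (T : measurableType d) (h : nat -> T -> \bar R)
    (f : T -> \bar R) : (forall n x, (0 <= h n x)%E) ->
  (forall x, f x = (\sum_(n <oo) ((p n)%:E * h n x))%E) ->
  forall x, (0 <= f x)%E.
Proof.
move=> h0 fE x; rewrite fE; apply: nneseries_ge0 => n _ _.
by rewrite mule_ge0// lee_fin.
Qed.

Lemma measurable_mixture d (T : measurableType d) (h : nat -> T -> \bar R)
    (f : T -> \bar R) : (forall n x, (0 <= h n x)%E) ->
  (forall n, measurable_fun setT (h n)) ->
  (forall x, f x = (\sum_(n <oo) ((p n)%:E * h n x))%E) ->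
  measurable_fun setT f.
Proof.
move=> h0 mh /funext ->; apply: ge0_emeasurable_sum => [n x _ _|n _].
  by rewrite mule_ge0// lee_fin.
exact: measurable_funeM.
Qed.

Lemma integral_mixture d (T : measurableType d) (m : {measure set T -> \bar R})
    (A : set T) (h : nat -> T -> \bar R) (f : T -> \bar R) :
  measurable A -> (forall n x, (0 <= h n x)%E) ->
  (forall n, measurable_fun setT (h n)) ->
  (forall x, f x = (\sum_(n <oo) ((p n)%:E * h n x))%E) ->
  (\int[m]_(x in A) f x = \sum_(n <oo) ((p n)%:E * \int[m]_(x in A) h n x))%E.
Proof.
move=> mA h0 mh /funext ->; rewrite integral_nneseries//; last 2 first.
- by move=> n; apply: measurable_funTS; exact: measurable_funeM.
- by move=> n x _; rewrite mule_ge0// lee_fin.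
apply: eq_eseriesr => n _; rewrite ge0_integralZl ?lee_fin//.
exact: measurable_funTS.
Qed.

Let h1 n := prod_g g (n.+1%:R * a1 + n.+1%:R * a3) (n.+1%:R * a2).
Let h2 n := prod_g g (n.+1%:R * a1) (n.+1%:R * a2 + n.+1%:R * a3).
Let h0 n y := (n.+1%:R * a3 / (n.+1%:R * a1 + n.+1%:R * a2 + n.+1%:R * a3) *
   g (n.+1%:R * a1 + n.+1%:R * a2 + n.+1%:R * a3) y)%:E.

Let h1_ge0 n z : (0 <= h1 n z)%E.
Proof. by apply: prod_g_ge0 => //; rewrite ?addr_gt0 ?sc_gt0. Qed.

Let h2_ge0 n z : (0 <= h2 n z)%E.
Proof. by apply: prod_g_ge0 => //; rewrite ?addr_gt0 ?sc_gt0. Qed.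

Let h0_ge0 n y : (0 <= h0 n y)%E.
Proof.
rewrite lee_fin mulr_ge0 ?g_ge0 ?addr_gt0 ?sc_gt0//.
by rewrite divr_ge0// ltW ?addr_gt0 ?sc_gt0.
Qed.

Let mh1 n : measurable_fun setT (h1 n). Proof. exact: measurable_prod_g. Qed.

Let mh2 n : measurable_fun setT (h2 n). Proof. exact: measurable_prod_g. Qed.

Let mh0 n : measurable_fun setT (h0 n).
Proof. by apply/measurable_EFinP; exact: measurable_funM. Qed.

Lemma f1_ge0 z : (0 <= f1 z)%E. Proof. exact: (mixture_ge0 h1_ge0 f1E). Qed.

Lemma f2_ge0 z : (0 <= f2 z)%E. Proof. exact: (mixture_ge0 h2_ge0 f2E). Qed.

Lemma f0_ge0 y : (0 <= f0 y)%E. Proof. exact: (mixture_ge0 h0_ge0 f0E). Qed.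

Lemma measurable_f1 : measurable_fun setT f1.
Proof. exact: (measurable_mixture h1_ge0 mh1 f1E). Qed.

Lemma measurable_f2 : measurable_fun setT f2.
Proof. exact: (measurable_mixture h2_ge0 mh2 f2E). Qed.

Lemma measurable_f0 : measurable_fun setT f0.
Proof. exact: (measurable_mixture h0_ge0 mh0 f0E). Qed.

Lemma quadrant_mixture_mass y1 y2 :
  (\int[(mu \x mu)%E]_(z in quadrant y1 y2 `&` lower) f1 z
   + \int[(mu \x mu)%E]_(z in quadrant y1 y2 `&` upper) f2 z
   + \int[mu]_(y in `]-oo, Num.min y1 y2]) f0 y =
  \sum_(n <oo) (p n * if (y1 <= y2)%R
    then G (n.+1%:R * a1 + n.+1%:R * a3) y1 * G (n.+1%:R * a2) y2
    else G (n.+1%:R * a1) y1 * G (n.+1%:R * a2 + n.+1%:R * a3) y2)%:E)%E.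
Proof.
have mQL : measurable (quadrant y1 y2 `&` lower).
  by apply: measurableI; [exact: measurable_quadrant|exact: measurable_lower].
have mQU : measurable (quadrant y1 y2 `&` upper).
  by apply: measurableI; [exact: measurable_quadrant|exact: measurable_upper].
have e1 := integral_mixture (mu \x mu)%E mQL h1_ge0 mh1 f1E.
have e2 := integral_mixture (mu \x mu)%E mQU h2_ge0 mh2 f2E.
have e0 := integral_mixture mu (measurable_itv `]-oo, Num.min y1 y2]) h0_ge0 mh0 f0E.
have ph d (T : measurableType d) (m : {measure set T -> \bar R}) (B : set T)
    (h : nat -> T -> \bar R) n : (forall n x, (0 <= h n x)%E) ->
    (0 <= (p n)%:E * \int[m]_(x in B) h n x)%E.
  by move=> h_ge0; rewrite mule_ge0 ?lee_fin ?integral_ge0.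
rewrite e1 e2 e0.
rewrite -!nneseriesD//; last 4 first.
- by move=> n _ _; rewrite ?adde_ge0 ?ph.
- by move=> n _ _; rewrite ?adde_ge0 ?ph.
- by move=> n _ _; rewrite ?adde_ge0 ?ph.
- by move=> n _ _; rewrite ?adde_ge0 ?ph.
apply: eq_eseriesr => n _.
have j1 : (0 <= \int[(mu \x mu)%E]_(z in quadrant y1 y2 `&` lower) h1 n z)%E.
  exact: integral_ge0.
have j2 : (0 <= \int[(mu \x mu)%E]_(z in quadrant y1 y2 `&` upper) h2 n z)%E.
  exact: integral_ge0.
have j0 : (0 <= \int[mu]_(y in `]-oo, Num.min y1 y2]) h0 n y)%E.
  exact: integral_ge0.
rewrite -ge0_muleDr// -ge0_muleDr//; last exact: adde_ge0.
rewrite (quadrant_mass g_ge0 G_ge0 mg integral_g gG) ?sc_gt0//. 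
Qed.

(** The law of the pair and the sum of the three candidate parts are both measures on the plane, so
    agreement on quadrants is enough. *)
Lemma density_formula d (Omega : measurableType d) (P : probability Omega R)
    (Y1 Y2 : Omega -> R) (F : R -> R -> R) :
  measurable_fun setT Y1 -> measurable_fun setT Y2 ->
  (forall y1 y2, P [set w | Y1 w <= y1 /\ Y2 w <= y2] = (F y1 y2)%:E) ->
  (forall y1 y2, (\sum_(n <oo) (p n * if (y1 <= y2)%R
    then G (n.+1%:R * a1 + n.+1%:R * a3) y1 * G (n.+1%:R * a2) y2
    else G (n.+1%:R * a1) y1 * G (n.+1%:R * a2 + n.+1%:R * a3) y2)%:E)%E =
    (F y1 y2)%:E) ->
  forall A : set (R * R), measurable A ->
  P ((fun w => (Y1 w, Y2 w)) @^-1` A) =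
  (\int[(mu \x mu)%E]_(z in A `&` lower) f1 z
   + \int[(mu \x mu)%E]_(z in A `&` upper) f2 z
   + \int[mu]_(y in [set y | A (y, y)]) f0 y)%E.
Proof.
move=> mY1 mY2 PF sF A mA.
have mY : measurable_fun setT (fun w => (Y1 w, Y2 w)).
  exact/measurable_fun_pairP.
have mdiag : measurable_fun setT (fun y : R => (y, y)).
  by apply/measurable_fun_pairP; split; exact: measurable_id.
(* Zero extension turns the two off-diagonal parts into densities on the whole plane. *)
have mfl : measurable_fun setT (f1 \_ lower).
  apply/(measurable_restrict _ measurable_lower measurableT).
  by apply: measurable_funTS; exact: measurable_f1.
have mfu : measurable_fun setT (f2 \_ upper).
  apply/(measurable_restrict _ measurable_upper measurableT).
  by apply: measurable_funTS; exact: measurable_f2.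
have fl0 z : (0 <= (f1 \_ lower) z)%E by apply: erestrict_ge0 => ? _; exact: f1_ge0.
have fu0 z : (0 <= (f2 \_ upper) z)%E by apply: erestrict_ge0 => ? _; exact: f2_ge0.
pose m1 := image_measure P mY.
(* The lebesgue measure lives on a copy of [R] with another canonical
   measurable structure, hence the image measures under the identity. *)
have midl : measurable_fun setT (fun z : R * R => z) := @measurable_id _ _ setT.
pose ml : {measure set (R * R) -> \bar R} :=
  image_measure (density (mu \x mu)%E mfl fl0) midl.
pose mr : {measure set (R * R) -> \bar R} :=
  image_measure (density (mu \x mu)%E mfu fu0) midl.
(* The singular part is carried to the diagonal by [y |-> (y, y)]. *)
pose md : {measure set (R * R) -> \bar R} :=
  image_measure (density mu measurable_f0 f0_ge0) mdiag.
pose m2 := measure_add (measure_add ml mr) md.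
have m2E B : m2 B =
  (\int[(mu \x mu)%E]_(z in B `&` lower) f1 z
   + \int[(mu \x mu)%E]_(z in B `&` upper) f2 z
   + \int[mu]_(y in [set y | B (y, y)]) f0 y)%E.
  have e1 : m2 B = (measure_add ml mr B + md B)%E := measure_addE _ _ _.
  have e2 : measure_add ml mr B = (ml B + mr B)%E := measure_addE _ _ _.
  apply: (etrans e1); rewrite e2.
  have -> : ml B = (\int[(mu \x mu)%E]_(z in B `&` lower) f1 z)%E.
    by rewrite integral_mkcondr.
  have -> : mr B = (\int[(mu \x mu)%E]_(z in B `&` upper) f2 z)%E.
    by rewrite integral_mkcondr.
  by [].
have m1E a b : m1 (quadrant a b) = (F a b)%:E by rewrite -PF.
rewrite -m2E; apply: (@measure_unique_quadrants _ m1 m2) => //.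
- move=> a b; apply: (etrans (m1E a b)); apply: esym; apply: (etrans (m2E _)).
  rewrite -sF -quadrant_mixture_mass.
  (* The point [(y, y)] lies in the quadrant exactly when [y <= Num.min a b]. *)
  congr (_ + integral _ _ _)%E; apply/seteqP; split => y; rewrite /= in_itv/=.
    by rewrite le_min => /andP.
  by rewrite le_min => /andP.
- by move=> a b; rewrite [ltLHS](m1E a b) ltry.
Qed.

End mixture.

(** * Series expansions of the cdf and of the three densities *)

Lemma nneseries_EFin (R : realType) (u : nat -> R) (l : R) :
  series u @ \oo --> l -> (\sum_(n <oo) (u n)%:E)%E = l%:E.
Proof.
move=> ul; apply/cvg_lim => //.
rewrite (_ : (fun n => _) = EFin \o series u).
  by apply: cvg_EFin => //; near=> n.
by apply/funext => n /=; rewrite sumEFin.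
Unshelve. all: by end_near. Qed.

Section expansions.
Context {R : realType}.
Variables (a : nat -> R) (theta : R).
Hypothesis a0 : forall n, (1 <= n)%N -> 0 <= a n.
Hypothesis theta0 : 0 < theta.
Hypothesis cva : exists2 t, theta < t & cvgn (pseries (coef0 a) t).
Hypothesis C0 : 0 < Cpow a theta.

Let coef0_ge0 n : 0 <= coef0 a n.
Proof. by case: n => [//|n]; exact: a0. Qed.

(** The probability of the value [n.+1] under the power series distribution attached to [C] and
    [theta]. *)
Definition weight n : R := a n.+1 * theta ^+ n.+1 / Cpow a theta.

Lemma weight_ge0 n : 0 <= weight n.
Proof. by rewrite /weight !mulr_ge0 ?a0 ?exprn_ge0 ?invr_ge0// ltW. Qed.

Let cvK K : 0 < K -> K <= 1 ->
  exists2 t, theta * K < t & cvgn (pseries (coef0 a) t).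
Proof.
move=> K0 K1; case: cva => t tt ct; exists t => //.
by rewrite (le_lt_trans _ tt)// ler_piMr// ltW.
Qed.

(** Only convergence of the series itself is involved, so [K = 0] is allowed; this covers points
    with a nonpositive coordinate. *)
Lemma weight_Cpow K : 0 <= K -> K <= 1 ->
  (\sum_(n <oo) (weight n * K ^+ n.+1)%:E)%E =
  (Cpow a (theta * K) / Cpow a theta)%:E.
Proof.
move=> K0 K1; apply: nneseries_EFin.
rewrite (_ : series _ = fun n => pseries (coef0 a) (theta * K) n.+1 / Cpow a theta).
  apply: cvgM; last exact: cvg_cst.
  rewrite (cvg_shiftS (pseries (coef0 a) (theta * K))) CpowE.
  case: cva => t tt ct; apply: (is_cvg_pseries_inside ct).
  rewrite !ger0_norm; last 2 first.
  - by rewrite ltW// (lt_trans theta0).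
  - by rewrite mulr_ge0// ltW.
  by rewrite (le_lt_trans _ tt)// ler_piMr// ltW.
apply/funext => n; rewrite /pseries /series/= big_nat_recl//= mul0r add0r.
by rewrite mulr_suml; apply: eq_bigr => i _; rewrite /weight exprMn; ring.
Qed.

Lemma weight_dC (K c g : R) : 0 < K -> K <= 1 ->
  (\sum_(n <oo) (weight n * (c * (n.+1%:R * K ^+ n * g)))%:E)%E =
  (theta * c / Cpow a theta * g * dC a (theta * K))%:E.
Proof.
move=> K0 K1; apply: nneseries_EFin.
rewrite (_ : series _ = fun n => theta * c / Cpow a theta * g *
    [series i.+1%:R * a i.+1 * (theta * K) ^+ i]_i n).
  apply: cvgM; first exact: cvg_cst.
  exact: (cvg_dC coef0_ge0 (mulr_gt0 theta0 K0) (cvK K0 K1)).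
apply/funext => n; rewrite /series/= mulr_sumr.
by apply: eq_bigr => i _; rewrite /weight exprMn exprS; ring.
Qed.

(** Each coordinate supplies a factor [n.+1]; their product gives the squared coefficient of
    [cvg_d2C_dC], and one factor [theta] comes out of [weight n]. *)
Lemma weight_d2C (K L gK gL : R) : 0 < K -> 0 < L -> K <= 1 -> L <= 1 ->
  (\sum_(n <oo) (weight n *
     ((n.+1%:R * K ^+ n * gK) * (n.+1%:R * L ^+ n * gL)))%:E)%E =
  (theta / Cpow a theta * gK * gL *
   (theta * (K * L) * d2C a (theta * (K * L)) + dC a (theta * (K * L))))%:E.
Proof.
move=> K0 L0 K1 L1; apply: nneseries_EFin.
have KL0 := mulr_gt0 K0 L0; have KL1 : K * L <= 1 by rewrite mulr_ile1// ltW.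
rewrite (_ : series _ = fun n => theta / Cpow a theta * gK * gL *
    [series i.+1%:R ^+ 2 * a i.+1 * (theta * (K * L)) ^+ i]_i n).
  apply: cvgM; first exact: cvg_cst.
  exact: (cvg_d2C_dC coef0_ge0 (mulr_gt0 theta0 KL0) (cvK KL0 KL1)).
apply/funext => n; rewrite /series/= mulr_sumr.
by apply: eq_bigr => i _; rewrite /weight !exprMn exprS; ring.
Qed.

Variable lam : R.
Hypothesis lam0 : 0 < lam.

Lemma prod_fGE_expansion (be ga : R) (z : R * R) : 0 < be -> 0 < ga ->
  (theta / Cpow a theta * fGE be lam z.1 * fGE ga lam z.2 *
   (theta * (FGE be lam z.1 * FGE ga lam z.2) *
      d2C a (theta * (FGE be lam z.1 * FGE ga lam z.2))
    + dC a (theta * (FGE be lam z.1 * FGE ga lam z.2))))%:E =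
  (\sum_(n <oo) ((weight n)%:E *
     prod_g (fun b => fGE b lam) (n.+1%:R * be) (n.+1%:R * ga) z))%E.
Proof.
move=> be0 ga0.
(* If a coordinate is nonpositive both sides vanish through [fGE], so the derivative series are
   invoked only at positive arguments. *)
have [z10|z10] := leP z.1 0.
  rewrite fGE_le0// mulr0 !mul0r eseries0// => n _ _.
  by rewrite /prod_g fGE_le0// mul0r mule0.
have [z20|z20] := leP z.2 0.
  rewrite (fGE_le0 _ ga)// mulr0 !mul0r eseries0// => n _ _.
  by rewrite /prod_g (fGE_le0 _ (n.+1%:R * ga))// mulr0 mule0.
rewrite -weight_d2C ?FGE_gt0 ?FGE_le1 ?(ltW be0) ?(ltW ga0)//.
by apply: eq_eseriesr => n _; rewrite /prod_g -!fGE_mulrn// EFinM.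
Qed.

Lemma fGE_expansion (be c y : R) : 0 < be ->
  (theta * c / Cpow a theta * fGE be lam y * dC a (theta * FGE be lam y))%:E =
  (\sum_(n <oo) ((weight n)%:E * (c * fGE (n.+1%:R * be) lam y)%:E))%E.
Proof.
move=> be0; have [y0|y0] := leP y 0.
  rewrite fGE_le0// mulr0 mul0r eseries0// => n _ _.
  by rewrite fGE_le0// mulr0 mule0.
rewrite -weight_dC ?FGE_gt0 ?FGE_le1 ?(ltW be0)//.
by apply: eq_eseriesr => n _; rewrite -fGE_mulrn// EFinM.
Qed.

End expansions.

(** * A convergence point beyond [theta], and the BGEPS density *)

Lemma cvgn_beyond (R : realType) (a : nat -> R) (s : \bar R) (theta : R) :
  (forall t, 0 < t -> (t%:E < s)%E -> cvgn [series a n.+1 * t ^+ n.+1]_n) ->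
  0 < theta -> (theta%:E < s)%E ->
  exists2 t, theta < t & cvgn (pseries (coef0 a) t).
Proof.
move=> cva theta0 thetas.
suff [t tt ts] : exists2 t, theta < t & (t%:E < s)%E.
  exists t => //; have /cvg_ex[/= l hl] := cva t (lt_trans theta0 tt) ts.
  apply/cvg_ex; exists l; rewrite -(cvg_shiftS (pseries (coef0 a) t)).
  rewrite (_ : (fun _ => _) = [series a n.+1 * t ^+ n.+1]_n)//.
  apply/funext => n.
  by rewrite /pseries /series/= big_nat_recl//= mul0r add0r.
(* The point is the midpoint of [theta] and [s] for finite [s], and [theta + 1] for infinite [s]. *)
case: s thetas {cva} => [r||//].
- rewrite lte_fin => tr; exists ((theta + r) / 2); last rewrite lte_fin; lra.
- by move=> _; exists (theta + 1); rewrite ?ltry// ltrDl.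
Qed.

Unset Implicit Arguments.

Theorem theorem1 (R : realType) (a : nat -> R) (s : \bar R)
  (a1 a2 a3 lam theta : R)
  (d : measure_display) (Omega : measurableType d) (P : probability Omega R)
  (Y1 Y2 : Omega -> R) :
  (forall n, (1 <= n)%N -> 0 <= a n) ->
  (forall t, 0 < t -> (t%:E < s)%E ->
     cvgn [series a n.+1 * t ^+ n.+1]_n) ->
  0 < theta -> (theta%:E < s)%E -> 0 < Cpow a theta ->
  0 < a1 -> 0 < a2 -> 0 < a3 -> 0 < lam ->
  measurable_fun setT Y1 -> measurable_fun setT Y2 ->
  (forall y1 y2 : R,
     P [set w | Y1 w <= y1 /\ Y2 w <= y2] = (F_BGEPS a a1 a2 a3 lam theta y1 y2)%:E) ->
  forall A : set (R * R)%type, measurable A ->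
    A `<=` [set z | 0 < z.1 /\ 0 < z.2] ->
    P ((fun w => (Y1 w, Y2 w)) @^-1` A) =
      (\int[(lebesgue_measure \x lebesgue_measure)%E]_(z in A `&` [set z | (z.1 < z.2)%R])
          (f1_BGEPS a a1 a2 a3 lam theta z.1 z.2)%:E
       + \int[(lebesgue_measure \x lebesgue_measure)%E]_(z in A `&` [set z | (z.2 < z.1)%R])
          (f2_BGEPS a a1 a2 a3 lam theta z.1 z.2)%:E
       + \int[lebesgue_measure]_(y in [set y | A (y, y)])
          (f0_BGEPS a a1 a2 a3 lam theta y)%:E)%E.
Proof.
move=> a_ge0 cva theta0 thetas C0 a10 a20 a30 lam0 mY1 mY2 PF A mA _.
have cvt := cvgn_beyond cva theta0 thetas.
have a130 := addr_gt0 a10 a30; have a230 := addr_gt0 a20 a30.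
have S0 : 0 < a1 + a2 + a3 by rewrite !addr_gt0.
have g_ge0 be x : 0 < be -> 0 <= fGE be lam x by move=> h; rewrite fGE_ge0// ltW.
have G_ge0 be x : 0 <= FGE be lam x by exact: FGE_ge0.
have gG be ga x : 0 < be -> 0 < ga -> fGE be lam x * FGE ga lam x =
    be / (be + ga) * fGE (be + ga) lam x.
  by move=> be0 ga0; rewrite fGE_FGE// gt_eqF// addr_gt0.
apply: (@density_formula R (fun be x => fGE be lam x) (fun be x => FGE be lam x)
  g_ge0 G_ge0 (measurable_fGE lam) (fun be b => @integral_fGE R lam lam0 be b) gG
  (weight a theta) a1 a2 a3 (weight_ge0 a_ge0 theta0 C0) a10 a20 a30
  (fun z => (f1_BGEPS a a1 a2 a3 lam theta z.1 z.2)%:E)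
  (fun z => (f2_BGEPS a a1 a2 a3 lam theta z.1 z.2)%:E)
  (fun y => (f0_BGEPS a a1 a2 a3 lam theta y)%:E)
  _ _ _ _ _ P Y1 Y2 _ mY1 mY2 PF) => //.
- move=> z; rewrite /f1_BGEPS prod_fGE_expansion//.
  by apply: eq_eseriesr => n _; rewrite -mulrDr.
- move=> z; rewrite /f2_BGEPS prod_fGE_expansion//.
  by apply: eq_eseriesr => n _; rewrite -mulrDr.
- move=> y; rewrite /f0_BGEPS.
  have -> : theta * a3 / (Cpow a theta * (a1 + a2 + a3)) =
      theta * (a3 / (a1 + a2 + a3)) / Cpow a theta.
    by field; rewrite !gt_eqF.
  (* The diagonal share [a3 / (a1 + a2 + a3)] is invariant under scaling by [n.+1], hence common to
     all components. *)
  rewrite fGE_expansion//; apply: eq_eseriesr => n _; rewrite -!mulrDr.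
  have n0 : n.+1%:R != 0 :> R by rewrite pnatr_eq0.
  by rewrite -mulf_div divff// mul1r.
(* Multiplying a shape parameter by [n.+1] raises its cdf to that power, so the mixture of component
   cdfs is the series of [C] at [theta] times the product of cdfs. *)
- move=> y1 y2; rewrite /F_BGEPS; case: ifPn => _.
    rewrite -weight_Cpow//; last 2 first.
    + by rewrite mulr_ge0.
    + by rewrite mulr_ile1// FGE_le1// ltW.
    by apply: eq_eseriesr => n _; rewrite -mulrDr !FGE_mulrn exprMn.
  rewrite -weight_Cpow//; last 2 first.
  + by rewrite mulr_ge0.
  + by rewrite mulr_ile1// FGE_le1// ltW.
  by apply: eq_eseriesr => n _; rewrite -mulrDr !FGE_mulrn exprMn.
Qed.
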